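(* Let $Y$ be a real random variable with law $\mathbb{P}_Y$, and for each integer $n\geq 1$ let $$Y_n=\frac{[nY]}{n}+\frac{1}{2n}.$$ If $\mathbb{P}_Y$ is a Rajchman measure, then, as $n\to\infty$, $$(n(Y_n-Y),Y)\ \stackrel{d}{\Longrightarrow}\ (V,Y),$$ where $V$ is uniformly distributed on $(-\frac12,\frac12)$ and independent of $Y$, and for every $\varphi\in\mathcal{C}^1\cap \mathrm{Lip}$ $$n^2\,\mathbb{E}[(\varphi(Y_n)-\varphi(Y))^2]\ \rightarrow\ \frac{1}{12}\,\mathbb{E}_Y[\varphi^{\prime 2}].$$
   Context: $[x]$ denotes the integer part of $x$ (the largest integer $\le x$). $\stackrel{d}{\Longrightarrow}$ denotes weak convergence of the laws (convergence against bounded continuous functions). $\mathbb{E}_Y$ is the expectation under $\mathbb{P}_Y$, i.e. $\mathbb{E}_Y[g]=\int g\,d\mathbb{P}_Y$. $\mathcal{C}^1\cap \mathrm{Lip}$ is the set of continuously differentiable Lipschitz functions on $\mathbb{R}$. A bounded measure on $\mathbb{R}$ is called a Rajchman measure if its Fourier transform vanishes at infinity. *)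

(* Defs.v *)
From HB Require Import structures.
From mathcomp Require Import all_boot all_order all_algebra.
From mathcomp Require Import all_classical all_reals all_analysis.
From mathcomp Require Import measurable_realfun complex.

Set Implicit Arguments.
Unset Strict Implicit.
Unset Printing Implicit Defensive.

Import Order.TTheory GRing.Theory Num.Theory.
Import numFieldNormedType.Exports.

Local Open Scope classical_set_scope.
Local Open Scope ring_scope.

(* [ny]/n + 1/(2n), the midpoint of the cell [k/n, (k+1)/n[ containing y; the
   value at n = 0 is irrelevant. *)
Definition quantize (R : realType) (n : nat) (y : R) : R :=
  (Num.floor (n%:R * y))%:~R / n%:R + (2 * n%:R)^-1.

Section random_variables.
Context d (Omega : measurableType d) (R : realType).

Lemma measurable_quantize n : measurable_fun [set: R] (@quantize R n).
Proof.
have h : {homo @quantize R n : x y / x <= y}.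
  move=> x y xy; rewrite /quantize lerD2r ler_wpM2r ?invr_ge0//.
  by rewrite ler_int le_floor// ler_wpM2l.
by apply: nondecreasing_measurable => // x y _ _; exact: h.
Qed.

Definition quantized_rv n (Y : {mfun Omega >-> R}) : Omega -> R :=
  fun w => quantize n (Y w).

Lemma measurable_quantized_rv n Y :
  measurable_fun [set: Omega] (quantized_rv n Y).
Proof. exact: measurableT_comp (measurable_quantize n) _. Qed.

HB.instance Definition _ n Y :=
  isMeasurableFun.Build _ _ _ _ (quantized_rv n Y)
    (measurable_quantized_rv n Y).

Definition scaled_error n (Y : {mfun Omega >-> R}) : Omega -> R :=
  fun w => n%:R * (quantized_rv n Y w - Y w).

Lemma measurable_scaled_error n Y :
  measurable_fun [set: Omega] (scaled_error n Y).
Proof.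
apply: measurable_funM => //; apply: measurable_funB => //.
Qed.

HB.instance Definition _ n Y :=
  isMeasurableFun.Build _ _ _ _ (scaled_error n Y)
    (measurable_scaled_error n Y).

Definition pair_rv (X Y : {mfun Omega >-> R}) : Omega -> R * R :=
  fun w => (X w, Y w).

Lemma measurable_pair_rv X Y : measurable_fun [set: Omega] (pair_rv X Y).
Proof. by apply: measurable_fun_pair. Qed.

HB.instance Definition _ X Y :=
  isMeasurableFun.Build _ _ _ _ (pair_rv X Y) (measurable_pair_rv X Y).

End random_variables.

(* The convention is int e^{i t x} mu(dx), with real part int cos(tx) mu(dx) and
   imaginary part int sin(tx) mu(dx); other normalizations only rescale t. *)
Definition fourier (R : realType) (mu : {finite_measure set R -> \bar R})
    (t : R) : R[i] :=
  ((\int[mu]_x cos (t * x)) +i* (\int[mu]_x sin (t * x)))%C.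

Definition Rajchman (R : realType) (mu : {finite_measure set R -> \bar R}) :=
  (ComplexField.Normc.normc (fourier mu t) @[t --> +oo] --> (0 : R)) /\
  (ComplexField.Normc.normc (fourier mu t) @[t --> -oo] --> (0 : R)).

Definition weak_cvg (R : realType) (mu_ : nat -> probability (R * R)%type R)
    (mu : probability (R * R)%type R) :=
  forall f : R * R -> R, continuous f -> bounded_fun f ->
    (\int[mu_ n]_z (f z)%:E)%E @[n --> \oo] --> (\int[mu]_z (f z)%:E)%E.

(* Two measures are identified when they agree on measurable sets: the
   underlying set functions may differ on the others. *)
Definition same_law d (T : measurableType d) (R : realType)
    (mu nu : set T -> \bar R) :=
  forall A, measurable A -> mu A = nu A.

Definition independent_rv d (Omega : measurableType d) (R : realType)
    (P : probability Omega R) (X Y : {RV P >-> R}) :=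
  forall A B : set R, measurable A -> measurable B ->
    P (X @^-1` A `&` Y @^-1` B) = (P (X @^-1` A) * P (Y @^-1` B))%E.

Lemma ltNhalf (R : realType) : - 2^-1 < 2^-1 :> R.
Proof. by rewrite gtrN// invr_gt0. Qed.

Definition C1_Lip (R : realType) (phi : R -> R) :=
  [/\ forall x, derivable phi x 1, continuous (derive1 phi) & lipschitz phi].

(* Main.v *)
(* Let [v_n = n (Y_n - Y)], which equals [1/2 - nY] modulo [1]. For [k >= 1] and fixed
   [m], the Rajchman property makes [cos (2 pi k n Y + c)] and
   [cos (2 pi k m Y + c)] asymptotically orthogonal as [n --> \oo]; a bounded
   asymptotically orthogonal sequence converges weakly to [0] in [L^2], so
   [E[g(Y) cos (2 pi k v_n + c)] --> 0] for every bounded measurable [g]. Sampling a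
   continuous [F(v, y)] that vanishes at [v = +-1/2] on a grid in [v], with Fejer
   kernels as weights, approximates it by such trigonometric functions up to an
   error of small mean; multiplying by [1 - fejer] reduces the general case to
   this one. For the mean square error, [n (phi(Y_n) - phi(Y))] is [v_n phi'(Y)]
   up to a bounded error tending to [0], and [v^2 phi'(y)^2] is a test function
   on [|v| <= 1/2]. *)

From HB Require Import structures.
Require Import Defs.
From mathcomp Require Import all_boot all_order all_algebra.
From mathcomp Require Import all_classical all_reals all_analysis.
From mathcomp Require Import measurable_realfun complex ring lra.
Import Order.TTheory GRing.Theory Num.Theory.
Import numFieldNormedType.Exports.
Local Open Scope classical_set_scope.
Local Open Scope ring_scope.

Set Implicit Arguments.
Unset Strict Implicit.
Unset Printing Implicit Defensive.

(** * Bounded measurable functions *)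

Section bounded_measurable.
Context d (T : measurableType d) (R : realType).
Implicit Types (f g : T -> R) (m : probability T R).

(** Such functions are integrable for every probability, so the integrability conditions of
    linearity and monotonicity reduce to closure properties of this class. *)
Definition bmeas f := measurable_fun [set: T] f /\ exists B, forall x, `|f x| <= B.

Lemma bmeas_integrable m f : bmeas f -> m.-integrable [set: T] (EFin \o f).
Proof.
move=> [mf [B fB]]; apply: measurable_bounded_integrable => //.
  exact: (le_lt_trans (probability_le1 _ _) (ltry _)).
exists B; split; first exact: num_real.
by move=> M BM x _ /=; rewrite (le_trans (fB x)) ?ltW.
Qed.

Lemma bmeas_cst r : bmeas (fun=> r).
Proof. by split; [exact: measurable_cst|exists `|r|]. Qed.

Lemma bmeasD f g : bmeas f -> bmeas g -> bmeas (fun x => f x + g x).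
Proof.
move=> [mf [B fB]] [mg [C gC]]; split; first exact: measurable_funD.
by exists (B + C) => x; rewrite (le_trans (ler_normD _ _))// lerD.
Qed.

Lemma bmeasM f g : bmeas f -> bmeas g -> bmeas (fun x => f x * g x).
Proof.
move=> [mf [B fB]] [mg [C gC]]; split; first exact: measurable_funM.
by exists (B * C) => x; rewrite normrM ler_pM.
Qed.

Lemma bmeasZ r f : bmeas f -> bmeas (fun x => r * f x).
Proof. by apply: bmeasM; exact: bmeas_cst. Qed.

Lemma bmeasB f g : bmeas f -> bmeas g -> bmeas (fun x => f x - g x).
Proof.
move=> bf bg; under [X in bmeas X]eq_fun do rewrite -mulN1r.
by apply: bmeasD => //; exact: bmeasZ.
Qed.

Lemma bmeas_norm f : bmeas f -> bmeas (fun x => `|f x|).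
Proof.
move=> [mf [B fB]]; split; first exact: measurableT_comp.
by exists B => x; rewrite normr_id.
Qed.

Lemma bmeas_sum (I : Type) (s : seq I) (F : I -> T -> R) :
  (forall i, bmeas (F i)) -> bmeas (fun x => \sum_(i <- s) F i x).
Proof.
move=> bF; elim: s => [|i s IH].
  by under [X in bmeas X]eq_fun do rewrite big_nil; exact: bmeas_cst.
by under [X in bmeas X]eq_fun do rewrite big_cons; exact: bmeasD.
Qed.

Lemma bmeas_indic (A : set T) : measurable A -> bmeas (\1_A : T -> R).
Proof.
move=> mA; split; first exact: measurable_indic.
by exists 1 => x; rewrite indicE; case: (_ \in _); rewrite ?normr0 ?normr1.
Qed.

Lemma bmeas_intD m f g : bmeas f -> bmeas g ->
  \int[m]_x (f x + g x) = \int[m]_x f x + \int[m]_x g x.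
Proof. by move=> bf bg; rewrite RintegralD//; exact: bmeas_integrable. Qed.

Lemma bmeas_intB m f g : bmeas f -> bmeas g ->
  \int[m]_x (f x - g x) = \int[m]_x f x - \int[m]_x g x.
Proof. by move=> bf bg; rewrite RintegralB//; exact: bmeas_integrable. Qed.

Lemma bmeas_intZ m r f : bmeas f ->
  \int[m]_x (r * f x) = r * \int[m]_x f x.
Proof. by move=> bf; rewrite RintegralZl//; exact: bmeas_integrable. Qed.

Lemma int_cst m r : \int[m]_x r = r.
Proof.
rewrite Rintegral_cst// -[RHS]mulr1; congr (_ * _).
exact: (congr1 fine (probability_setT m)).
Qed.

Lemma bmeas_int_sum m (I : Type) (s : seq I) (F : I -> T -> R) :
  (forall i, bmeas (F i)) ->
  \int[m]_x (\sum_(i <- s) F i x) = \sum_(i <- s) \int[m]_x F i x.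
Proof.
move=> bF; elim: s => [|i s IH].
  by rewrite big_nil; under eq_Rintegral do rewrite big_nil; exact: int_cst.
rewrite big_cons -IH -bmeas_intD//; last exact: bmeas_sum.
by apply: eq_Rintegral => x _; rewrite big_cons.
Qed.

Lemma bmeas_le_int m f g : bmeas f -> bmeas g -> (forall x, f x <= g x) ->
  \int[m]_x f x <= \int[m]_x g x.
Proof. by move=> bf bg fg; apply: le_Rintegral => //; exact: bmeas_integrable. Qed.

Lemma bmeas_norm_int m f g : bmeas f -> bmeas g -> (forall x, `|f x| <= g x) ->
  `|\int[m]_x f x| <= \int[m]_x g x.
Proof.
move=> bf bg fg.
rewrite (le_trans (le_normr_Rintegral _ (bmeas_integrable m bf)))//.
by apply: bmeas_le_int => //; exact: bmeas_norm.
Qed.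

Lemma bmeas_intE m f : bmeas f ->
  (\int[m]_x (f x)%:E)%E = (\int[m]_x f x)%:E.
Proof.
move=> bf; rewrite /Rintegral fineK//.
exact: (integrable_fin_num _ (bmeas_integrable m bf)).
Qed.

End bounded_measurable.

Lemma bmeas_comp d d' (T : measurableType d) (T' : measurableType d')
    (R : realType) (f : T' -> R) (h : T -> T') :
  bmeas f -> measurable_fun [set: T] h -> bmeas (fun x => f (h x)).
Proof.
move=> [mf [B fB]] mh; split; first exact: measurableT_comp.
by exists B => x.
Qed.

Lemma bmeas_int_distribution d d' (T : measurableType d) (T' : measurableType d')
    (R : realType) (P : probability T R) (X : {mfun T >-> T'}) (f : T' -> R) :
  bmeas f -> \int[distribution P X]_y f y = \int[P]_x f (X x).
Proof.
move=> bf; rewrite /Rintegral integral_distribution//.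
  by apply/measurable_EFinP; case: bf.
exact/bmeas_integrable/bmeas_comp.
Qed.

(* Among the functions [S] with [\int S h_n --> 0], take one whose distance to
   [g] is nearly minimal: adding multiples of [h_n] to [S] cannot decrease the
   distance much, hence [\int (g - S) h_n] is small. *)
Lemma weak_cvg0_almost_orthogonal d (T : measurableType d) (R : realType)
    (P : probability T R) (h : nat -> T -> R) (g : T -> R) :
  (forall n, measurable_fun [set: T] (h n)) ->
  (forall n x, `|h n x| <= 1) ->
  (forall m, \int[P]_x (h m x * h n x) @[n --> \oo] --> 0) ->
  bmeas g -> \int[P]_x (g x * h n x) @[n --> \oo] --> 0.
Proof.
move=> mh h1 hh bg.
have bh n : bmeas (h n) by split; [exact: mh|exists 1 => x; exact: h1].
pose small S := bmeas S /\ (\int[P]_x (S x * h n x) @[n --> \oo] --> 0).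
pose dist S := \int[P]_x ((g x - S x) ^+ 2).
have b2 f : bmeas f -> bmeas (fun x => f x ^+ 2).
  by move=> bf; under [X in bmeas X]eq_fun do rewrite expr2; exact: bmeasM.
have small0 : small (fun=> 0).
  split; first exact: bmeas_cst.
  rewrite (_ : (fun n => _) = (fun=> 0)); first exact: cvg_cst.
  by apply/funext => n; under eq_Rintegral do rewrite mul0r; rewrite int_cst.
have smallD S t n : small S -> small (fun x => S x + t * h n x).
  move=> [bS S0]; split; first by apply: bmeasD => //; exact: bmeasZ.
  rewrite (_ : (fun k => _) = (fun k => \int[P]_x (S x * h k x) +
      t * \int[P]_x (h n x * h k x))).
    rewrite -[0]addr0; apply: cvgD => //.
    by rewrite -[0](mulr0 t); apply: cvgM => //; exact: cvg_cst.
  apply/funext => k; rewrite -bmeas_intZ; last exact: bmeasM.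
  rewrite -bmeas_intD; [|exact: bmeasM|by apply: bmeasZ; exact: bmeasM].
  by apply: eq_Rintegral => x _; ring.
pose D := [set dist S | S in small].
have D0 : has_inf D.
  split; first by exists (dist (fun=> 0)), (fun=> 0).
  by exists 0 => _ [S _ <-]; apply: Rintegral_ge0 => x _; exact: sqr_ge0.
apply/cvgrPdist_le => e e0.
have e20 : 0 < e / 2 by rewrite divr_gt0.
have [_ [S [bS S0] <-] Se] := inf_adherent (exprn_gt0 2 e20) D0.
have key n : `|\int[P]_x ((g x - S x) * h n x)| <= e / 2.
  (* The multiple of [h n] added to [S] is this integral itself. Since [\int h_n^2 <= 1], it lowers
     [dist S] by at least [t ^+ 2]; as [dist S < inf D + (e / 2) ^+ 2], this forces
     [|t| <= e / 2]. *)
  set t := \int[P]_x _.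
  have bgS : bmeas (fun x => g x - S x) by exact: bmeasB.
  have : inf D <= dist (fun x => S x + t * h n x).
    by apply: ge_inf; [case: D0|exists (fun x => S x + t * h n x)=> //; exact: smallD].
  have -> : dist (fun x => S x + t * h n x) =
      dist S + (- 2 * t) * t + t ^+ 2 * \int[P]_x (h n x ^+ 2).
    have bgSh : bmeas (fun x => (g x - S x) * h n x) by exact: bmeasM.
    transitivity (\int[P]_x ((g x - S x) ^+ 2 +
        ((- 2 * t) * ((g x - S x) * h n x) + t ^+ 2 * (h n x ^+ 2)))).
      by apply: eq_Rintegral => x _; ring.
    rewrite !bmeas_intD ?bmeas_intZ ?addrA//; try exact: b2; try exact: bmeasZ.
      exact/bmeasZ/b2.
    by apply: bmeasD; [exact: bmeasZ|exact/bmeasZ/b2].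
  have h21 : \int[P]_x (h n x ^+ 2) <= 1.
    rewrite -[leRHS](int_cst P); apply: bmeas_le_int => //.
    - exact: b2.
    - exact: bmeas_cst.
    - by move=> x; rewrite -real_normK ?num_real// exprn_ile1.
  have t2 : t ^+ 2 * \int[P]_x (h n x ^+ 2) <= t ^+ 2.
    by rewrite ler_piMr// sqr_ge0.
  move=> H; rewrite -ler_sqr ?nnegrE// ?(ltW e20)// real_normK ?num_real//.
  by rewrite /dist in Se H *; lra.
move/cvgrPdist_le: S0 => /(_ _ e20); apply: filterS => n.
rewrite !sub0r !normrN => Sn.
have -> : \int[P]_x (g x * h n x) =
    \int[P]_x ((g x - S x) * h n x) + \int[P]_x (S x * h n x).
  rewrite -bmeas_intD; [|by apply: bmeasM => //; exact: bmeasB|exact: bmeasM].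
  by apply: eq_Rintegral => x _; ring.
by rewrite (le_trans (ler_normD _ _))// [leRHS]splitr lerD.
Qed.

(** * Consequences of the Rajchman property *)

Lemma measurable_cos_comp d (T : measurableType d) (R : realType) (f : T -> R) :
  measurable_fun [set: T] f -> measurable_fun [set: T] (fun x => cos (f x)).
Proof.
move=> mf; apply: measurableT_comp mf.
by apply: continuous_measurable_fun; exact: continuous_cos.
Qed.

Lemma bmeas_cos d (T : measurableType d) (R : realType) (f : T -> R) :
  measurable_fun [set: T] f -> bmeas (fun x => cos (f x)).
Proof.
move=> mf; split; first exact: measurable_cos_comp.
by exists 1 => x; exact: cos_max.
Qed.

Section rajchman.
Context (R : realType) (mu : probability R R).
Hypothesis raj : Rajchman mu.

(** The addition formula removes the phase [c]; the remaining cosine and sine integrals are the real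
    and imaginary parts of the Fourier transform, hence bounded by its modulus. *)
Lemma rajchman_int_cos c : \int[mu]_y cos (t * y + c) @[t --> +oo] --> 0.
Proof.
have mt t : measurable_fun [set: R] (fun x => t * x) by exact: measurable_funM.
have bc t : bmeas (fun x : R => cos (t * x)) by exact: bmeas_cos.
have bs t : bmeas (fun x : R => sin (t * x)).
  split.
    apply: measurableT_comp (mt t).
    by apply: continuous_measurable_fun; exact: continuous_sin.
  by exists 1 => x; exact: sin_max.
rewrite (_ : (fun t => _) = (fun t => cos c * (\int[mu]_y cos (t * y)) -
    sin c * (\int[mu]_y sin (t * y)))); last first.
  apply/funext => t; rewrite -!bmeas_intZ// -bmeas_intB; [|exact: bmeasZ..].
  by apply: eq_Rintegral => y _; rewrite cosD mulrC (mulrC (sin c)).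
have [rajy _] := raj.
have lim0 (f : R -> R) : (forall t, `|f t| <= ComplexField.Normc.normc (fourier mu t)) ->
    f t @[t --> +oo] --> 0.
  move=> fn; apply/norm_cvg0P; apply: (squeeze_cvgr _ (cvg_cst 0) rajy).
  by apply: nearW => t; rewrite normr_ge0 fn.
have limc : \int[mu]_y cos (t * y) @[t --> +oo] --> 0.
  by apply: lim0 => t /=; rewrite -sqrtr_sqr ler_wsqrtr// lerDl sqr_ge0.
have lims : \int[mu]_y sin (t * y) @[t --> +oo] --> 0.
  by apply: lim0 => t /=; rewrite -sqrtr_sqr ler_wsqrtr// lerDr sqr_ge0.
have := cvgB (cvgM (cvg_cst (cos c)) limc) (cvgM (cvg_cst (sin c)) lims).
by rewrite !mulr0 subrr; apply.
Qed.

(** For fixed [m], the product-to-sum formula turns [\int h_m h_n] into cosine integrals at the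
    frequencies [2 pi k (n - m)] and [2 pi k (n + m)], which both tend to [+oo]; almost
    orthogonality then gives the claim for every weight [g]. *)
Lemma rajchman_int_cos_dilation (k : nat) c g : (0 < k)%N -> bmeas g ->
  \int[mu]_y (g y * cos (2 * pi * k%:R * (n%:R * y) + c)) @[n --> \oo] --> 0.
Proof.
move=> k0; pose h n (y : R) := cos (2 * pi * k%:R * (n%:R * y) + c).
have mh a b : measurable_fun [set: R] (fun y => 2 * pi * k%:R * (a * y) + b).
  by apply: measurable_funD => //; do 2 apply: measurable_funM => //.
apply: (@weak_cvg0_almost_orthogonal _ _ _ mu h).
- by move=> n; exact: measurable_cos_comp.
- by move=> n x; exact: cos_max.
move=> m; rewrite /h.
pose J b s := \int[mu]_y cos (s * y + b).
rewrite (_ : (fun n => _) = (fun n => 2^-1 * J 0 (2 * pi * k%:R * (n%:R - m%:R)) +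
   2^-1 * J (2 * c) (2 * pi * k%:R * (n%:R + m%:R)))); last first.
  apply/funext => n; rewrite /J -!bmeas_intZ; try (by apply: bmeas_cos;
    apply: measurable_funD => //; apply: measurable_funM).
  rewrite -bmeas_intD; try (by apply: bmeasZ; apply: bmeas_cos;
    apply: measurable_funD => //; apply: measurable_funM).
  apply: eq_Rintegral => y _.
  set p := _ * (m%:R * y) + c; set q := _ * (n%:R * y) + c.
  (* The phases cancel in the difference and add up to [2 * c] in the sum. *)
  rewrite (_ : _ * y + 0 = q - p); last by rewrite /p /q; ring.
  rewrite (_ : _ * y + 2 * c = q + p); last by rewrite /p /q; ring.
  by rewrite (cosB q) (cosD q); field.
have kpos : 0 < 2 * pi * k%:R :> R by rewrite !mulr_gt0 ?pi_gt0// ltr0n.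
have tooy (a : R) : 2 * pi * k%:R * (n%:R + a) @[n --> \oo] --> +oo.
  apply/cvgryPge => A.
  near=> n.
  rewrite -ler_pdivrMl// -lerBlDr.
  by near: n; exact: nbhs_infty_ger.
have J0 b (a : R) : J b (2 * pi * k%:R * (n%:R + a)) @[n --> \oo] --> 0.
  exact: cvg_comp (tooy a) (rajchman_int_cos b).
have := cvgD (cvgM (cvg_cst (2^-1 : R)) (J0 0 (- m%:R)))
  (cvgM (cvg_cst (2^-1 : R)) (J0 (2 * c) m%:R)).
by rewrite mulr0 addr0; apply.
Unshelve. all: by end_near. Qed.

End rajchman.

(** * Fejer kernels *)

Section fejer.
Context (R : realType).
Implicit Types (x a c : R) (L M j k l : nat).

Lemma cosD2pin x k : cos (x + 2 * pi * k%:R) = cos x.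
Proof.
elim: k => [|k IH]; first by rewrite mulr0 addr0.
rewrite -(natr1 k) (_ : x + _ = x + 2 * pi * k%:R + pi *+ 2); last by ring.
by rewrite cosD2pi.
Qed.

Lemma sinD2pin x k : sin (x + 2 * pi * k%:R) = sin x.
Proof.
elim: k => [|k IH]; first by rewrite mulr0 addr0.
rewrite -(natr1 k) (_ : x + _ = x + 2 * pi * k%:R + pi *+ 2); last by ring.
by rewrite sinD2pi.
Qed.

(** The factor makes the sum telescope: [2 sin a cos t = sin (t + a) - sin (t - a)]. *)
Lemma sum_cos_arith L a c :
  2 * sin a * (\sum_(k < L) cos (2 * a * k%:R + c)) =
  sin (2 * a * L%:R + c - a) - sin (c - a).
Proof.
elim: L => [|L IH]; first by rewrite big_ord0 !mulr0 add0r subrr.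
rewrite big_ord_recr/= mulrDr {}IH -(natr1 L).
set t := 2 * a * L%:R + c.
rewrite (_ : 2 * a * (L%:R + 1) + c - a = t + a); last by rewrite /t; ring.
by rewrite (sinB t) (sinD t); ring.
Qed.

Lemma sum_sin_arith L a c :
  2 * sin a * (\sum_(k < L) sin (2 * a * k%:R + c)) =
  cos (c - a) - cos (2 * a * L%:R + c - a).
Proof.
elim: L => [|L IH]; first by rewrite big_ord0 !mulr0 add0r subrr.
rewrite big_ord_recr/= mulrDr {}IH -(natr1 L).
set t := 2 * a * L%:R + c.
rewrite (_ : 2 * a * (L%:R + 1) + c - a = t + a); last by rewrite /t; ring.
by rewrite (cosB t) (cosD t); ring.
Qed.

(** With [a = pi j / M] the telescoped sum compares the sine at two points that differ by [2 pi j].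
    The bounds on [j] put [a] strictly between [0] and [pi], so [sin a] can be cancelled. *)
Lemma sum_cos_roots_of_unity M j c : (0 < j < M)%N ->
  \sum_(i < M) cos (2 * pi * j%:R * (i%:R / M%:R) + c) = 0.
Proof.
move=> /andP[j0 jM]; have M0 : 0 < M%:R :> R by rewrite ltr0n (leq_ltn_trans _ jM).
pose a : R := pi * j%:R / M%:R.
have sa : 0 < 2 * sin a.
  rewrite mulr_gt0//; apply: sin_gt0_pi.
  rewrite divr_gt0 ?mulr_gt0 ?pi_gt0 ?ltr0n ?(leq_ltn_trans _ jM)//=.
  by rewrite ltr_pdivrMr// ltr_pM2l ?pi_gt0// ltr_nat.
apply: (mulfI (lt0r_neq0 sa)); rewrite mulr0.
transitivity (2 * sin a * \sum_(i < M) cos (2 * a * i%:R + c)).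
  congr (_ * _); apply: eq_bigr => i _; congr (cos (_ + _)).
  by rewrite /a; field; rewrite lt0r_neq0.
rewrite sum_cos_arith (_ : _ + c - a = c - a + 2 * pi * j%:R).
  by rewrite sinD2pin subrr.
by rewrite /a; field; rewrite lt0r_neq0.
Qed.

Lemma sum_cos_orthogonal M k l x : (k < M)%N -> (l < M)%N ->
  \sum_(i < M) cos (2 * pi * (k%:R - l%:R) * (x - i%:R / M%:R)) =
  if k == l then M%:R else 0.
Proof.
move=> kM lM; case: ltngtP => [kl|lk|->].
- rewrite -[RHS](@sum_cos_roots_of_unity M (l - k) (- (2 * pi * (l - k)%:R * x))).
    apply: eq_bigr => i _; congr cos; rewrite natrB ?(ltnW kl)//; ring.
  by rewrite subn_gt0 kl (leq_ltn_trans (leq_subr _ _) lM).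
- rewrite -[RHS](@sum_cos_roots_of_unity M (k - l) (- (2 * pi * (k - l)%:R * x))).
    by apply: eq_bigr => i _; rewrite -cosN; congr cos; rewrite natrB ?(ltnW lk)//; ring.
  by rewrite subn_gt0 lk (leq_ltn_trans (leq_subr _ _) kM).
- under eq_bigr do rewrite subrr mulr0 mul0r cos0.
  by rewrite sumr_const card_ord.
Qed.

(* The Fejer kernel divided by [L], so that its maximum is [1] and its mean over
   a period is [1 / L]. *)
Definition fejer L x : R := (L%:R ^+ 2)^-1 *
  ((\sum_(k < L) cos (2 * pi * k%:R * x)) ^+ 2 +
   (\sum_(k < L) sin (2 * pi * k%:R * x)) ^+ 2).

Lemma fejer_ge0 L x : 0 <= fejer L x.
Proof. by rewrite mulr_ge0 ?invr_ge0 ?addr_ge0 ?sqr_ge0. Qed.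

(** Expanding the squared modulus of the exponential sum gives a trigonometric polynomial, the form
    suited to integration; the sum of two squares shows nonnegativity. *)
Lemma fejerE L x : fejer L x = (L%:R ^+ 2)^-1 *
  \sum_(k < L) \sum_(l < L) cos (2 * pi * (k%:R - l%:R) * x).
Proof.
rewrite /fejer; congr (_ * _).
rewrite !expr2 !big_distrlr/= -big_split/=; apply: eq_bigr => k _.
rewrite -big_split/=; apply: eq_bigr => l _.
by rewrite -cosB; congr cos; ring.
Qed.

Lemma fejer_nat L k : (0 < L)%N -> fejer L k%:R = 1.
Proof.
move=> L0; rewrite fejerE.
under eq_bigr => i _.
  under eq_bigr => j _.
    rewrite (_ : _ * _ = 2 * pi * (i * k)%:R - 2 * pi * (j * k)%:R); last first.
      by rewrite !natrM; ring.
    rewrite cosB -[2 * pi * (i * k)%:R]add0r -[2 * pi * (j * k)%:R]add0r.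
    rewrite !cosD2pin !sinD2pin cos0 sin0 mulr1 mulr0 addr0.
    over.
  rewrite sumr_const card_ord.
  over.
by rewrite sumr_const card_ord -mulrnA mulnn natrX mulVf// expf_neq0// pnatr_eq0 -lt0n.
Qed.

(** At [x = +-1/2] the argument is the integer [1] or [0]. Hence [1 - fejer] is a continuous cutoff
    vanishing at both endpoints. *)
Lemma fejer_endpoint L x : (0 < L)%N -> `|x| = 2^-1 -> fejer L (x + 2^-1) = 1.
Proof.
move=> L0; case: (lerP 0 x) => x0; rewrite ?(ger0_norm x0) ?(ltr0_norm x0) => x2.
  by rewrite (_ : x + _ = 1%:R) ?fejer_nat//; lra.
by rewrite (_ : x + _ = 0%:R) ?fejer_nat//; lra.
Qed.

(** The kernel is [(sin (pi L x) / (L sin (pi x)))^2]. Bounding the numerator through the telescoped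
    sums avoids dividing by a sine that may vanish. *)
Lemma sin2_fejer_le L x : (0 < L)%N ->
  sin (pi * x) ^+ 2 * fejer L x <= (L%:R ^+ 2)^-1.
Proof.
move=> L0; rewrite /fejer mulrCA ler_piMr ?invr_ge0 ?sqr_ge0//.
set a := pi * x.
have -> : \sum_(k < L) cos (2 * pi * k%:R * x) = \sum_(k < L) cos (2 * a * k%:R + 0).
  by apply: eq_bigr => k _; congr cos; rewrite /a; ring.
have -> : \sum_(k < L) sin (2 * pi * k%:R * x) = \sum_(k < L) sin (2 * a * k%:R + 0).
  by apply: eq_bigr => k _; congr sin; rewrite /a; ring.
set C := \sum_(k < L) cos _; set S := \sum_(k < L) sin _.
have := sum_cos_arith L a 0; have := sum_sin_arith L a 0.
rewrite -/C -/S; set b := 2 * a * L%:R + 0 - a; rewrite sub0r sinN cosN opprK => hS hC.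
have ab : -1 <= cos (b + a) by exact: cos_geN1.
rewrite cosD in ab.
have := cos2Dsin2 a; have := cos2Dsin2 b => hb ha.
(* By [hS] and [hC] the left side is [(sin a + sin b)^2 + (cos a - cos b)^2 = 2 - 2 cos (a + b)]. *)
have : (2 * sin a * C) ^+ 2 + (2 * sin a * S) ^+ 2 <= 4.
  by rewrite hS hC; nra.
by nra.
Qed.

(** A partition of unity: by discrete orthogonality only the [M] diagonal terms of [fejerE] survive,
    each contributing [M], against the prefactor [1 / M^2]. *)
Lemma sum_fejer M x : (0 < M)%N -> \sum_(i < M) fejer M (x - i%:R / M%:R) = 1.
Proof.
move=> M0; under eq_bigr do rewrite fejerE.
rewrite -mulr_sumr exchange_big/=.
under eq_bigr => k _.
  rewrite exchange_big/=.
  under eq_bigr => l _ do rewrite sum_cos_orthogonal//.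
  rewrite -big_mkcond/= (big_pred1 k); last by move=> l; rewrite eq_sym.
  over.
by rewrite sumr_const card_ord -mulrnA mulnn natrX mulVf// expf_neq0// pnatr_eq0 -lt0n.
Qed.

End fejer.

Lemma continuous_bigsum (R : realType) (I : Type) (s : seq I) (F : I -> R -> R) :
  (forall i, continuous (F i)) -> continuous (fun x => \sum_(i <- s) F i x).
Proof.
move=> cF; elim: s => [|i s IH] x.
  by under eq_fun do rewrite big_nil; exact: cvg_cst.
by under eq_fun do rewrite big_cons; apply: cvgD; [exact: cF|exact: IH].
Qed.

Lemma fejer_continuous (R : realType) (L : nat) : continuous (@fejer R L).
Proof.
rewrite (_ : fejer L = fun x : R => (L%:R ^+ 2)^-1 *
    \sum_(k < L) \sum_(l < L) cos (2 * pi * (k%:R - l%:R) * x)); last first.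
  by apply/funext => x; exact: fejerE.
move=> x; apply: cvgM; first exact: cvg_cst.
apply: continuous_bigsum => k; apply: continuous_bigsum => l {}x.
apply: (continuous_comp _ (@continuous_cos R _)).
by apply: cvgM; [exact: cvg_cst|exact: cvg_id].
Qed.

(** * The uniform law on [-1/2, 1/2] *)

Lemma integral_derive (R : realType) (f F : R -> R) (a b : R) : a < b ->
  (forall x : R, is_derive x 1 F (f x)) -> continuous f ->
  (\int[lebesgue_measure]_(x in `[a, b]) (f x)%:E = (F b)%:E - (F a)%:E)%E.
Proof.
move=> ab dF cf.
have cF : continuous F.
  by move=> x; apply: differentiable_continuous; apply/derivable1_diffP; case: (dF x).
apply: continuous_FTC2 => //.
- exact: continuous_subspaceT.
- split; first by move=> x _; case: (dF x).
    by apply: cvg_at_right_filter; exact: cF.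
  by apply: cvg_at_left_filter; exact: cF.
- by move=> x _; rewrite derive1E; case: (dF x).
Qed.

Section uniform_law.
Context (R : realType).

Definition of_measurableTypeR (x : measurableTypeR R) : R := x.

HB.instance Definition _ := isMeasurableFun.Build _ _ (measurableTypeR R) R
  of_measurableTypeR (@measurable_id _ (measurableTypeR R) setT).

(* [uniform_prob] lives on [measurableTypeR R]; this is the same law on the
   canonical measurable structure of [R]. *)
Definition uniform_half : probability R R :=
  distribution (uniform_prob (ltNhalf R)) of_measurableTypeR.

Lemma uniform_half_same_law : same_law uniform_half (uniform_prob (ltNhalf R)).
Proof. by []. Qed.

Context (u : probability R R).
Hypothesis unif : same_law u (uniform_prob (ltNhalf R)).

Lemma uniform_int (f : R -> R) : bmeas f -> (forall x, 0 <= f x) ->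
  (\int[u]_x (f x)%:E =
   \int[lebesgue_measure]_(x in `[(- 2^-1)%R, 2^-1%R]) (f x)%:E)%E.
Proof.
move=> bf f0; have mf : measurable_fun [set: R] (fun x => (f x)%:E).
  by apply/measurable_EFinP; case: bf.
rewrite (eq_measure_integral uniform_half); last by move=> A mA _; exact: unif.
rewrite ge0_integral_distribution//.
rewrite (integral_uniform (ltNhalf R) (f := fun x : measurableTypeR R => (f x)%:E)).
- by rewrite opprK (_ : 2^-1 + 2^-1 = 1) ?invr1 ?mul1e//; lra.
- exact: mf.
- by move=> x; rewrite lee_fin.
Qed.

Lemma uniform_int_cos (k : nat) c : (0 < k)%N ->
  \int[u]_v cos (2 * pi * k%:R * v + c) = 0.
Proof.
move=> k0; pose a : R := 2 * pi * k%:R.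
have a0 : a != 0 by rewrite !mulf_neq0 ?pnatr_eq0 -?lt0n// lt0r_neq0// pi_gt0.
have bc : bmeas (fun v : R => cos (a * v + c)).
  by apply: bmeas_cos; apply: measurable_funD => //; exact: measurable_funM.
(* The constant [1] makes the integrand nonnegative, as [uniform_int] requires. *)
suff : (\int[u]_v (1 + cos (a * v + c))%:E = 1)%E.
  rewrite bmeas_intE; last by apply: bmeasD => //; exact: bmeas_cst.
  rewrite bmeas_intD//; last exact: bmeas_cst.
  by rewrite int_cst => -[] /eqP; rewrite -subr_eq0 addrC addKr => /eqP.
rewrite uniform_int; first last.
- by move=> x; rewrite -lerBlDl sub0r cos_geN1.
- by apply: bmeasD => //; exact: bmeas_cst.
pose F (x : R) := x + a^-1 * sin (a * x + c).
have dF (x : R) : is_derive x 1 F (1 + cos (a * x + c)).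
  by apply: is_derive_eq; rewrite /GRing.scale/=; field.
rewrite (integral_derive _ dF) ?ltNhalf//; last first.
  move=> x; apply: cvgD; first exact: cvg_cst.
  apply: continuous_comp; last exact: continuous_cos.
  by apply: cvgD; [apply: cvgM; [exact: cvg_cst|exact: cvg_id]|exact: cvg_cst].
(* The arguments of the sine at the two endpoints differ by [2 pi k], so the sines cancel. *)
rewrite -EFinB /F (_ : a * 2^-1 + c = a * - 2^-1 + c + 2 * pi * k%:R).
  by rewrite sinD2pin; congr EFin; field.
by rewrite /a; field.
Qed.

Lemma uniform_out : \int[u]_v \1_[set v : R | 2^-1 < `|v|] v = 0.
Proof.
have mA : measurable [set v : R | 2^-1 < `|v|].
  rewrite -[X in measurable X]setTI.
  by apply: measurable_fun_ltr => //; exact: measurableT_comp.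
apply: EFin_inj; rewrite -bmeas_intE; last exact: bmeas_indic.
rewrite uniform_int; [|exact: bmeas_indic|by move=> x; rewrite indicE].
rewrite integral0_eq// => x /=; rewrite in_itv/= -ler_norml => xh.
by rewrite indicE memNset//=; apply/negP; rewrite -leNgt.
Qed.

(** Truncation at [1/4] makes the square bounded on the whole line and changes nothing on
    [[-1/2, 1/2]]. *)
Lemma bmeas_min_sqr : bmeas (fun v : R => Num.min (v ^+ 2) (4^-1)).
Proof.
split.
  by apply: measurable_minr => //; exact: measurable_funX.
exists 4^-1 => x; rewrite ger0_norm; first by rewrite ge_min lexx orbT.
by rewrite le_min sqr_ge0 invr_ge0 ler0n.
Qed.

Lemma uniform_int_sqr : \int[u]_v Num.min (v ^+ 2) (4^-1) = 12^-1.
Proof.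
apply: EFin_inj; rewrite -bmeas_intE; last exact: bmeas_min_sqr.
rewrite uniform_int; [|exact: bmeas_min_sqr|]; last first.
  by move=> x; rewrite le_min sqr_ge0 invr_ge0 ler0n.
transitivity (\int[lebesgue_measure]_(x in `[(- 2^-1)%R, (2^-1)%R]) ((x : R) ^+ 2)%:E)%E.
  apply: eq_integral.
  move=> x; rewrite inE/= in_itv/= -ler_norml => xh; congr EFin.
  apply/min_idPl; rewrite -[_ ^+ 2]real_normK ?num_real//.
  rewrite (_ : 4^-1 = 2^-1 ^+ 2 :> R); last by field.
  by rewrite ler_sqr ?nnegrE// ?invr_ge0.
pose F (x : R) := 3^-1 * x ^+ 3.
have dF (x : R) : is_derive x 1 F (x ^+ 2).
  by apply: is_derive_eq; rewrite /GRing.scale/=; field.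
rewrite (integral_derive _ dF) ?ltNhalf//; last exact: exprn_continuous.
by rewrite -EFinB /F; congr EFin; field.
Qed.

End uniform_law.

Lemma int_prodM (R : realType) (u mu : probability R R) (f g : R -> R) :
  bmeas f -> bmeas g ->
  \int[(u \x mu)%E]_z (f z.1 * g z.2) = \int[u]_x f x * \int[mu]_y g y.
Proof.
move=> bf bg.
have bfg : bmeas (fun z : R * R => f z.1 * g z.2).
  by apply: bmeasM; apply: bmeas_comp.
apply: EFin_inj; rewrite -bmeas_intE// -integral12_prod_meas1; last first.
  exact: bmeas_integrable.
rewrite /fubini_F/=.
under eq_integral => x _.
  rewrite bmeas_intE; last exact: bmeasZ.
  rewrite bmeas_intZ//.
  over.
rewrite bmeas_intE; last by apply: bmeasM => //; exact: bmeas_cst.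
under eq_Rintegral do rewrite mulrC.
by rewrite bmeas_intZ// mulrC.
Qed.

(** * Convergence of integrals *)

Section quantization.
Context (R : realType).

Lemma quantize_error n (y : R) : (0 < n)%N ->
  n%:R * (quantize n y - y) = (Num.floor (n%:R * y))%:~R + 2^-1 - n%:R * y.
Proof.
move=> n0; have : n%:R != 0 :> R by rewrite pnatr_eq0 -lt0n.
by move=> n1; rewrite /quantize; field.
Qed.

Lemma quantize_error_le n (y : R) : `|n%:R * (quantize n y - y)| <= 2^-1.
Proof.
case: n => [|n]; first by rewrite mul0r normr0 invr_ge0.
rewrite quantize_error// ler_norml.
have := floor_le_tmp (n.+1%:R * y); have := floorD1_gt (n.+1%:R * y).
rewrite intrD; lra.
Qed.

Lemma quantize_cvg (y : R) : quantize n y @[n --> \oo] --> y.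
Proof.
apply/cvgrPdist_le => e e0.
near=> n.
have n0 : (0 < n)%N by near: n; exact: nbhs_infty_gt.
have n1 : 0 < n%:R :> R by rewrite ltr0n.
rewrite distrC -(ler_pM2l n1) -[n%:R in leLHS]gtr0_norm// -normrM.
rewrite (le_trans (quantize_error_le _ _))//.
rewrite -ler_pdivrMr//.
by near: n; exact: nbhs_infty_ger.
Unshelve. all: by end_near. Qed.

Lemma measurable_quantize_eq (n : nat) (k : int) :
  measurable [set y : R | Num.floor (n%:R * y) = k].
Proof.
pose h (y : R) : R := (Num.floor (n%:R * y))%:~R.
have hh : {homo h : x y / x <= y}.
  by move=> x y xy; rewrite /h ler_int le_floor// ler_wpM2l.
have mh : measurable_fun [set: R] h.
  by apply: nondecreasing_measurable => // x y _ _; exact: hh.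
rewrite (_ : [set y | _] = [set: R] `&` h @^-1` [set k%:~R]); first exact: mh.
rewrite setTI; apply/seteqP; split => y /=; first by move=> <-.
by move=> /eqP; rewrite eqr_int => /eqP.
Qed.

(* The product sigma-algebra is not presented as generated by open sets, so the
   first variable is discretized. *)
Lemma continuous_measurable_fun2 (f : R * R -> R) :
  continuous f -> measurable_fun [set: R * R] f.
Proof.
move=> cf; pose h n (z : R * R) := f (quantize n z.1, z.2).
apply: (@measurable_fun_cvg _ _ _ _ h) => [n|z _]; last first.
  apply: continuous_cvg; first exact: cf.
  by case: z => v y; exact: (cvg_pair (@quantize_cvg v) (cvg_cst _)).
move=> _ Y mY; rewrite setTI.
(* On the cell where the floor equals [k] the quantized first coordinate is the constant [q k], so
   the preimage is a countable union of rectangles. *)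
pose q (k : int) : R := k%:~R / n%:R + (2 * n%:R)^-1.
rewrite (_ : _ @^-1` _ = \bigcup_(k in [set: int])
   ([set y : R | Num.floor (n%:R * y) = k] `*` [set y | Y (f (q k, y))])); last first.
  apply/seteqP; split => [z Yz|z [k _ [/= <- ]]//].
  by exists (Num.floor (n%:R * z.1)).
apply: countable_bigcupT_measurable => // k.
apply: measurableX; first exact: measurable_quantize_eq.
rewrite -[X in measurable X]setTI.
apply: (continuous_measurable_fun (f := fun y => f (q k, y))) => //.
move=> y; apply: (continuous_comp (f := fun y => (q k, y))); last exact: cf.
exact: (cvg_pair (cvg_cst (q k)) cvg_id).
Qed.

End quantization.

(** * The vector space of test functions whose integrals converge *)

Section converging_integrals.
Context d (T : measurableType d) (R : realType).
Context (mu_ : nat -> probability T R) (nu : probability T R).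
Implicit Types f g : T -> R.

Definition cvg_int f :=
  bmeas f /\ \int[mu_ n]_x f x @[n --> \oo] --> \int[nu]_x f x.

Lemma cvg_intD f g : cvg_int f -> cvg_int g -> cvg_int (fun x => f x + g x).
Proof.
move=> [bf cf] [bg cg]; split; first exact: bmeasD.
rewrite bmeas_intD//; under eq_fun do rewrite bmeas_intD//.
exact: cvgD.
Qed.

Lemma cvg_intZ r f : cvg_int f -> cvg_int (fun x => r * f x).
Proof.
move=> [bf cf]; split; first exact: bmeasZ.
rewrite bmeas_intZ//; under eq_fun do rewrite bmeas_intZ//.
by apply: cvgM => //; exact: cvg_cst.
Qed.

Lemma cvg_int_cst r : cvg_int (fun=> r).
Proof.
split; first exact: bmeas_cst.
by rewrite int_cst; under eq_fun do rewrite int_cst; exact: cvg_cst.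
Qed.

Lemma cvg_int_sum (I : Type) (s : seq I) (F : I -> T -> R) :
  (forall i, cvg_int (F i)) -> cvg_int (fun x => \sum_(i <- s) F i x).
Proof.
move=> bF; elim: s => [|i s IH].
  by under [X in cvg_int X]eq_fun do rewrite big_nil; exact: cvg_int_cst.
by under [X in cvg_int X]eq_fun do rewrite big_cons; exact: cvg_intD.
Qed.

(** The error bound [h] need only be small in [nu]-mean: since [h] is itself a converging test
    function, its [mu_ n]-mean is at most [e / 2] for large [n]. The other two contributions are the
    [nu]-mean of [h] and the convergence for [g], at most [e / 4] each. *)
Lemma cvg_int_approx f : bmeas f ->
  (forall e, 0 < e -> exists g h, [/\ cvg_int g, cvg_int h,
     forall x, `|f x - g x| <= h x & \int[nu]_x h x <= e]) ->
  cvg_int f.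
Proof.
move=> bf fgh; split=> //; apply/cvgrPdist_le => e e0.
have e4 : 0 < e / 4 by rewrite divr_gt0.
have [g [h [[bg cg] [bh ch] fg he]]] := fgh _ e4.
have bfg : bmeas (fun x => f x - g x) by exact: bmeasB.
have dist (m : probability T R) : `|\int[m]_x f x - \int[m]_x g x| <= \int[m]_x h x.
  by rewrite -bmeas_intB//; exact: bmeas_norm_int.
near=> n.
have gn : `|\int[nu]_x g x - \int[mu_ n]_x g x| <= e / 4.
  by near: n; move/cvgrPdist_le : cg; exact.
have hn : `|\int[nu]_x h x - \int[mu_ n]_x h x| <= e / 4.
  by near: n; move/cvgrPdist_le : ch; exact.
have := dist nu; have := dist (mu_ n); move: gn hn.
rewrite !ler_norml; lra.
Unshelve. all: by end_near. Qed.

End converging_integrals.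

(* The left-hand side vanishes on the compact set where [sin (pi (v - s))] does,
   since there [v = s] or both are endpoints. *)
Lemma modulus_sin2 (R : realType) (F : R * R -> R) (B K e : R) :
  continuous F -> (forall z, `|F z| <= B) ->
  (forall v y, `|v| = 2^-1 -> F (v, y) = 0) -> 0 < e ->
  exists2 C, 0 <= C & forall v s y, `|v| <= 2^-1 -> `|s| <= 2^-1 -> `|y| <= K ->
    `|F (v, y) - F (s, y)| <= e + C * sin (pi * (v - s)) ^+ 2.
Proof.
move=> cF FB F0 e0.
pose I : set R := `[- 2^-1, 2^-1]%classic; pose J : set R := `[- K, K]%classic.
pose G (z : R * R * R) := `|F (z.1.1, z.2) - F (z.1.2, z.2)|.
pose S (z : R * R * R) := sin (pi * (z.1.1 - z.1.2)) ^+ 2.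
have c11 : continuous (fun z : R * R * R => z.1.1).
  by move=> z; apply: (continuous_comp (f := fst)); exact: cvg_fst.
have c12 : continuous (fun z : R * R * R => z.1.2).
  by move=> z; apply: (continuous_comp (f := fst)); [exact: cvg_fst|exact: cvg_snd].
have cG : continuous G.
  move=> z; apply: cvg_norm.
  apply: cvgB; apply: (continuous_comp _ (cF _)).
    exact: (cvg_pair (c11 z) cvg_snd).
  exact: (cvg_pair (c12 z) cvg_snd).
have cS : continuous S.
  move=> z; apply: (continuous_comp _ (@exprn_continuous R 2 _)).
  apply: (continuous_comp _ (@continuous_sin R _)).
  by apply: cvgM; [exact: cvg_cst|apply: cvgB; [exact: c11|exact: c12]].
(* [A] is the compact set where the difference is at least [e]. Off [A] the term [e] suffices; on
   [A] the continuous function [S] has a positive minimum [S c], and the trivial bound [2 * B] is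
   absorbed by [C = 2 * B / S c]. *)
pose A := (I `*` I `*` J) `&` [set z | e <= G z].
have cA : compact A.
  apply: compact_closedI.
    by apply: compact_setX; [apply: compact_setX|]; exact: segment_compact.
  exact: (closed_comp (fun z _ => cG z) (@closed_ge _ e)).
have [A0|/set0P A0] := eqVneq A set0.
  exists 0 => // v s y vI sI yK; rewrite mul0r addr0 leNgt; apply/negP => eG.
  suff : A ((v, s), y) by rewrite A0.
  by split; [split; [split|]|exact: ltW]; rewrite /I /J /= in_itv/= -ler_norml.
have [c Ac cmin] := compact_EVT_min A0 cA (continuous_subspaceT cS).
have Sc : 0 < S c.
  rewrite lt_neqAle sqr_ge0 andbT eq_sym expf_eq0/=; apply/eqP => s0.
  move: Ac; rewrite inE; case: c s0 {cmin} => -[v s] y /= s0.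
  rewrite /A /I /G/= !in_itv/= -!ler_norml => -[[[vI sI] _]] eG.
  have : `|v - s| <= 1 by move: vI sI; rewrite !ler_norml; lra.
  have [vs|vs] := eqVneq v s; first by move: eG; rewrite vs subrr normr0; lra.
  rewrite le_eqVlt => /orP[/eqP vs1|vs1].
    have [v2 s2] : `|v| = 2^-1 /\ `|s| = 2^-1.
      by have := ler_normB v s; rewrite vs1 => ?; split; lra.
    by move: eG; rewrite !F0// subrr normr0; lra.
  have : sin (pi * `|v - s|) = 0.
    have [->//|->] : `|v - s| = v - s \/ `|v - s| = - (v - s).
      by case: (ger0P (v - s)) => _; [left|right].
    by rewrite mulrN sinN s0 oppr0.
  apply/eqP; rewrite gt_eqF//; apply: sin_gt0_pi.
  by rewrite mulr_gt0 ?pi_gt0 ?normr_gt0 ?subr_eq0//= gtr_pMr ?pi_gt0.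
exists (2 * B / S c).
  by rewrite divr_ge0 ?(ltW Sc)// mulr_ge0// (le_trans _ (FB (0, 0))).
move=> v s y vI sI yK; have [eG|Ge] := lerP e (G ((v, s), y)); last first.
  rewrite (le_trans (ltW Ge))// lerDl mulr_ge0 ?sqr_ge0// divr_ge0 ?(ltW Sc)//.
  by rewrite mulr_ge0// (le_trans _ (FB (0, 0))).
have /cmin Smin : ((v, s), y) \in A.
  by rewrite inE; split; [split; [split|]|]; rewrite /I /J //= in_itv/= -ler_norml.
have GB : `|F (v, y) - F (s, y)| <= 2 * B.
  by rewrite (le_trans (ler_normB _ _))// mulr_natl mulr2n lerD.
rewrite (le_trans GB)// -[leLHS]add0r lerD ?(ltW e0)// mulrAC ler_pdivlMr//.
by rewrite ler_wpM2l// (le_trans _ GB).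
Qed.

(** The sets where [|f|] exceeds [n] decrease to the empty set, so continuity from above applies. *)
Lemma tail_int_small d (T : measurableType d) (R : realType)
    (nu : probability T R) (f : T -> R) (e : R) : measurable_fun [set: T] f -> 0 < e ->
  exists K, \int[nu]_x \1_[set x | K < `|f x|] x <= e.
Proof.
move=> mf e0; pose A n := [set x | n%:R < `|f x|].
have mA n : measurable (A n).
  rewrite /A -[X in measurable X]setTI.
  by apply: measurable_fun_ltr => //; exact: measurableT_comp.
have capA : \bigcap_n A n = set0.
  apply/seteqP; split => // x Ax.
  have := Ax (Num.truncn `|f x|).+1 I; rewrite /A/=.
  by rewrite ltNge ltW// truncnS_gt.
have : nu (A n) @[n --> \oo] --> nu (\bigcap_n A n).
  apply: nonincreasing_cvg_mu => //.
  - by rewrite (le_lt_trans (probability_le1 _ _)) ?ltry.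
  - by rewrite capA; exact: measurable0.
  - move=> n m nm; apply/subsetPset => x; rewrite /A/=.
    by apply: le_lt_trans; rewrite ler_nat.
rewrite capA measure0 => /fine_cvgP[_] /cvgrPdist_le /(_ e e0) [n _ /(_ n (leqnn n))].
rewrite /= sub0r normrN => ne; exists n%:R; rewrite (le_trans _ ne)//.
rewrite -[leLHS]/(\int[nu]_x \1_(A n) x) /Rintegral integral_indic// setIT.
exact: ler_norm.
Qed.

(** * From trigonometric test functions to all bounded continuous ones *)

Section equidistribution.
Context (R : realType) (mu_ : nat -> probability (R * R)%type R).
Context (nu : probability (R * R)%type R).
(** The estimate [modulus_sin2] covers only [|v| <= 1/2]; the complement has to be asymptotically
    negligible. *)
Let outside : set (R * R) := [set z | 2^-1 < `|z.1|].

(** Frequencies are written as differences to match the double sum in [fejerE]. *)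
Hypothesis trig_cvg : forall (g : R -> R) (k l : nat) c, bmeas g ->
  cvg_int mu_ nu (fun z => g z.2 * cos (2 * pi * (k%:R - l%:R) * z.1 + c)).
Hypothesis trig_mean : forall (k : nat) c, (0 < k)%N ->
  \int[nu]_z cos (2 * pi * k%:R * z.1 + c) = 0.
Hypothesis out_cvg : cvg_int mu_ nu \1_outside.
Hypothesis out_mean : \int[nu]_z \1_outside z = 0.

Lemma snd_cvg (g : R -> R) : bmeas g -> cvg_int mu_ nu (fun z => g z.2).
Proof.
move=> /(trig_cvg 0 0 0); congr (cvg_int _ _ _); apply/funext => z.
by rewrite subrr mulr0 mul0r addr0 cos0 mulr1.
Qed.

Lemma fejer_cvg (g : R -> R) (L : nat) s : bmeas g ->
  cvg_int mu_ nu (fun z => g z.2 * fejer L (z.1 + s)).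
Proof.
move=> bg; under [X in cvg_int _ _ X]eq_fun => z.
  rewrite fejerE mulrCA mulr_sumr.
  under eq_bigr do rewrite mulr_sumr.
  over.
apply: cvg_intZ; apply: cvg_int_sum => k; apply: cvg_int_sum => l.
under [X in cvg_int _ _ X]eq_fun do rewrite mulrDr.
exact: trig_cvg.
Qed.

(** Only the [L] diagonal terms of [fejerE] have nonzero mean, and the prefactor is [1 / L^2]. *)
Lemma fejer_mean (L : nat) s : (0 < L)%N ->
  \int[nu]_z fejer L (z.1 + s) = L%:R^-1.
Proof.
move=> L0.
have bcos (k l : nat) : bmeas (fun z : R * R => cos (2 * pi * (k%:R - l%:R) * (z.1 + s))).
  apply: bmeas_cos; apply: measurable_funM => //.
  exact: measurable_funD.
have mean (k l : nat) : \int[nu]_z cos (2 * pi * (k%:R - l%:R) * (z.1 + s)) =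
    if k == l then 1 else 0.
  case: ltngtP => [kl|lk|->].
  - rewrite -[RHS](@trig_mean (l - k) (2 * pi * (l - k)%:R * s)) ?subn_gt0//.
    by apply: eq_Rintegral => z _; rewrite -cosN natrB ?(ltnW kl)//; congr cos; ring.
  - rewrite -[RHS](@trig_mean (k - l) (2 * pi * (k - l)%:R * s)) ?subn_gt0//.
    by apply: eq_Rintegral => z _; rewrite natrB ?(ltnW lk)//; congr cos; ring.
  - under eq_Rintegral do rewrite subrr mulr0 mul0r cos0.
    exact: int_cst.
under eq_Rintegral do rewrite fejerE.
rewrite bmeas_intZ; last by do 2 (apply: bmeas_sum => ?).
rewrite bmeas_int_sum; last by move=> k; exact: bmeas_sum.
under eq_bigr => k _.
  rewrite bmeas_int_sum//.
  under eq_bigr do rewrite mean.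
  rewrite -big_mkcond/= (big_pred1 k); last by move=> l; rewrite eq_sym.
  over.
rewrite sumr_const card_ord expr2; field.
by rewrite pnatr_eq0 -lt0n.
Qed.

(** The approximant averages the samples [F (s i, y)] with the Fejer weights, which sum to [1].
    Where [modulus_sin2] applies, the constant part of its bound costs [e / 4], and the [sin^2] part
    costs at most [C / M^2] per node, that is [C / M] in all; elsewhere the error is at most
    [2 * B]. *)
Lemma cvg_int_vanishing (F : R * R -> R) (B : R) :
  continuous F -> (forall z, `|F z| <= B) ->
  (forall v y, `|v| = 2^-1 -> F (v, y) = 0) -> cvg_int mu_ nu F.
Proof.
move=> cF FB F0.
have bF : bmeas F by split; [exact: continuous_measurable_fun2|exists B].
have B0 : 0 <= B by rewrite (le_trans _ (FB (0, 0))).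
apply: cvg_int_approx => // e e0.
have e4 : 0 < e / 4 by rewrite divr_gt0.
(* The summand [1] keeps the denominator positive when [B = 0]. *)
have [K HK] : exists K, \int[nu]_z \1_[set z | K < `|z.2|] z <= (e / 4) / (2 * B + 1).
  by apply: tail_int_small => //; rewrite divr_gt0//; lra.
have [C C0 HC] := modulus_sin2 K cF FB F0 e4.
pose M := (Num.truncn (C / (e / 4))).+1.
have M0 : 0 < M%:R :> R by rewrite ltr0n.
have CM : C / M%:R <= e / 4.
  by rewrite ler_pdivrMr// mulrC -ler_pdivrMr// ltW// truncnS_gt.
pose s i : R := i%:R / M%:R - 2^-1.
pose tail : set R := [set y | K < `|y|].
have mtail : measurable tail.
  rewrite -[X in measurable X]setTI.
  by apply: measurable_fun_ltr => //; exact: measurableT_comp.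
exists (fun z => \sum_(i < M) F (s i, z.2) * fejer M (z.1 - s i)).
(* The two indicators pay the crude bound [2 * B] for large [|y|] and for [|v| > 1/2]. The [nu]-mean
   is at most [e / 4 + e / 4 + e / 4 + 0]. *)
exists (fun z => (e / 4 + C / M%:R) + (2 * B * \1_tail z.2 + 2 * B * \1_outside z)).
have bFs i : bmeas (fun y => F (s i, y)).
  by apply: (bmeas_comp bF); exact: measurable_fun_pair.
have sumf v : \sum_(i < M) fejer M (v - s i) = 1.
  rewrite -[RHS](@sum_fejer _ M (v + 2^-1) (ltn0Sn _)); apply: eq_bigr => i _.
  by congr fejer; rewrite /s; ring.
have t_cvg : cvg_int mu_ nu (fun z => 2 * B * \1_tail z.2).
  by apply: (@snd_cvg (fun y => 2 * B * \1_tail y)); apply: bmeasZ; exact: bmeas_indic.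
split.
- by apply: cvg_int_sum => i; exact: (@fejer_cvg (fun y => F (s i, y))).
- apply: cvg_intD; first exact: cvg_int_cst.
  by apply: cvg_intD => //; exact: cvg_intZ.
- move=> [v y] /=.
  have -> : F (v, y) = \sum_(i < M) F (v, y) * fejer M (v - s i).
    by rewrite -mulr_sumr sumf mulr1.
  rewrite -sumrB (le_trans (ler_norm_sum _ _ _))//.
  under eq_bigr do rewrite -mulrBl normrM (ger0_norm (fejer_ge0 _ _)).
  have crude : \sum_(i < M) `|F (v, y) - F (s i, y)| * fejer M (v - s i) <= 2 * B.
    have -> : 2 * B = \sum_(i < M) (2 * B) * fejer M (v - s i).
      by rewrite -mulr_sumr sumf mulr1.
    apply: ler_sum => i _.
    rewrite ler_wpM2r ?fejer_ge0// (le_trans (ler_normB _ _))//.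
    by rewrite mulr_natl mulr2n lerD.
  have CM0 : 0 <= C / M%:R by rewrite divr_ge0// ltW.
  have i1 : 0 <= 2 * B * \1_tail y by rewrite !mulr_ge0// indicE.
  have i2 : 0 <= 2 * B * \1_outside (v, y) by rewrite !mulr_ge0// indicE.
  have [yK|Ky] := lerP `|y| K; last first.
    have i3 : \1_tail y = 1 :> R by rewrite indicE mem_set.
    by rewrite i3 mulr1 in i1 *; lra.
  have [vI|Iv] := lerP `|v| 2^-1; last first.
    have i3 : \1_outside (v, y) = 1 :> R by rewrite indicE mem_set.
    by rewrite i3 mulr1 in i2 *; lra.
  suff : \sum_(i < M) `|F (v, y) - F (s i, y)| * fejer M (v - s i) <= e / 4 + C / M%:R.
    by lra.
  have -> : e / 4 + C / M%:R =
      \sum_(i < M) (e / 4 * fejer M (v - s i) + C * (M%:R ^+ 2)^-1).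
    rewrite big_split/= -mulr_sumr sumf mulr1 sumr_const card_ord; congr (_ + _).
    by rewrite -mulr_natr; field; rewrite lt0r_neq0.
  apply: ler_sum => i _.
  have sI : `|s i| <= 2^-1.
    have i1M : i%:R / M%:R <= 1 :> R by rewrite ler_pdivrMr// mul1r ler_nat ltnW.
    have i0M : 0 <= i%:R / M%:R :> R by rewrite divr_ge0// ltW.
    by rewrite /s ler_norml; lra.
  rewrite (le_trans (ler_wpM2r (fejer_ge0 _ _) (HC v (s i) y vI sI yK)))//.
  by rewrite mulrDl lerD2l -mulrA ler_wpM2l// sin2_fejer_le.
- have btail : bmeas (fun z : R * R => \1_tail z.2 : R).
    exact: (@bmeas_comp _ _ _ _ R \1_tail snd (bmeas_indic _ mtail) measurable_snd).
  have [bout _] := out_cvg.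
  rewrite bmeas_intD; [|exact: bmeas_cst|by apply: bmeasD; exact: bmeasZ].
  rewrite int_cst bmeas_intD ?bmeas_intZ//; try exact: bmeasZ.
  rewrite out_mean mulr0 addr0.
  have : 2 * B * \int[nu]_z \1_tail z.2 <= e / 4.
    have i0 : 0 <= \int[nu]_z \1_tail z.2.
      by apply: Rintegral_ge0 => z _; rewrite indicE.
    rewrite (@le_trans _ _ ((2 * B + 1) * \int[nu]_z \1_tail z.2))//.
      by rewrite ler_wpM2r//; lra.
    by rewrite mulrC -ler_pdivlMr//; lra.
  by lra.
Qed.

(** With [w] the Fejer kernel peaking at [v = +-1/2], the function [f (1 - w)] vanishes there. The
    rest [f w] is dominated by [B w], whose [nu]-mean is [B / L], at most [e] by the choice of
    [L]. *)
Lemma cvg_int_continuous (f : R * R -> R) (B : R) :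
  continuous f -> (forall z, `|f z| <= B) -> cvg_int mu_ nu f.
Proof.
move=> cf fB.
have bf : bmeas f by split; [exact: continuous_measurable_fun2|exists B].
have B0 : 0 <= B by rewrite (le_trans _ (fB (0, 0))).
apply: cvg_int_approx => // e e0.
pose L := (Num.truncn (B / e)).+1.
have BL : B / L%:R <= e.
  by rewrite ler_pdivrMr ?ltr0n// mulrC -ler_pdivrMr// ltW// truncnS_gt.
pose w (z : R * R) : R := fejer L (z.1 + 2^-1).
have w_cvg : cvg_int mu_ nu w.
  have := fejer_cvg L 2^-1 (bmeas_cst R 1).
  by congr (cvg_int _ _ _); apply/funext => z; rewrite mul1r.
have [[_ [W wW]] _] := w_cvg.
have cw : continuous (w : R * R -> R).
  have cv : continuous (fun z : R * R => z.1 + 2^-1).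
    by move=> z; apply: cvgD; [exact: cvg_fst|exact: cvg_cst].
  move=> z; have cL : {for z.1 + 2^-1, continuous (@fejer R L)}.
    exact: fejer_continuous.
  exact: (continuous_comp (cv z) cL).
exists (fun z => f z * (1 - w z)), (fun z => B * w z); split.
- apply: (@cvg_int_vanishing _ (B * (1 + W))).
  + move=> z; apply: cvgM; first exact: cf.
    by apply: cvgB; [exact: cvg_cst|exact: cw].
  + move=> z; rewrite normrM ler_pM// (le_trans (ler_normB _ _))// normr1 lerD2l.
    exact: wW.
  + by move=> v y v2; rewrite /w/= fejer_endpoint// subrr mulr0.
- exact: cvg_intZ.
- move=> z; rewrite (_ : f z - _ = f z * w z); last by ring.
  by rewrite normrM (ger0_norm (fejer_ge0 _ _)) ler_wpM2r ?fejer_ge0.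
- have [bw _] := w_cvg.
  by rewrite bmeas_intZ// /w fejer_mean.
Qed.

End equidistribution.

(** * The quantization error *)

Lemma cosD2piz (R : realType) (x : R) (k : int) : cos (x + 2 * pi * k%:~R) = cos x.
Proof.
case: k => k; first exact: cosD2pin.
rewrite -[LHS](cosD2pin _ k.+1); congr cos.
by rewrite NegzE mulrNz pmulrn; ring.
Qed.

Section quantization_error.
Context d (Omega : measurableType d) (R : realType) (P : probability Omega R).
Context (Y : {RV P >-> R}) (u : probability R R).
Hypothesis raj : Rajchman (distribution P Y).
Hypothesis unif : same_law u (uniform_prob (ltNhalf R)).

Let mu : probability R R := distribution P Y.
Let nu : probability (R * R)%type R := (u \x mu)%E.
Let mu_ n : probability (R * R)%type R :=
  distribution P (pair_rv (scaled_error n Y) Y).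

(** The scaled error is a function of [Y], so integrals against the joint law become integrals
    against the law of [Y], to which the Rajchman property applies. *)
Lemma int_error_law n (f : R * R -> R) : bmeas f ->
  \int[mu_ n]_z f z = \int[mu]_y f (n%:R * (quantize n y - y), y).
Proof.
move=> bf; rewrite bmeas_int_distribution// bmeas_int_distribution//.
apply: bmeas_comp => //; apply: measurable_fun_pair => //.
apply: measurable_funM => //; apply: measurable_funB => //.
exact: measurable_quantize.
Qed.

Lemma error_cos_cvg (g : R -> R) (k : nat) c : (0 < k)%N -> bmeas g ->
  cvg_int mu_ nu (fun z => g z.2 * cos (2 * pi * k%:R * z.1 + c)).
Proof.
move=> k0 bg.
have bc : bmeas (fun x : R => cos (2 * pi * k%:R * x + c)).
  by apply: bmeas_cos; apply: measurable_funD => //; exact: measurable_funM.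
have bgc : bmeas (fun z : R * R => g z.2 * cos (2 * pi * k%:R * z.1 + c)).
  apply: bmeasM; first exact: bmeas_comp.
  exact: (bmeas_comp bc measurable_fst).
split => //.
have -> : \int[nu]_z (g z.2 * cos (2 * pi * k%:R * z.1 + c)) = 0.
  under eq_Rintegral do rewrite mulrC.
  by rewrite (int_prodM u mu bc bg) uniform_int_cos// mul0r.
(* Writing [v = F + 1/2 - n y] with [F] the floor of [n y], one has [-(2 pi k v + c) = 2 pi k n y -
   (pi k + c) - 2 pi k F]. The last term is a multiple of [2 pi], and the cosine is even. *)
have := rajchman_int_cos_dilation raj (- (pi * k%:R + c)) k0 bg.
apply: cvg_trans; apply: near_eq_cvg; near=> n.
rewrite int_error_law//; apply: eq_Rintegral => y _ /=; congr (_ * _).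
have n0 : (0 < n)%N by near: n; exact: nbhs_infty_gt.
rewrite quantize_error// -cosN; set F := Num.floor _.
rewrite -[LHS](cosD2piz _ (k%:Z * F)); congr cos.
by rewrite intrM -pmulrn; field.
Unshelve. all: by end_near. Qed.

Lemma error_trig_cvg (g : R -> R) (k l : nat) c : bmeas g ->
  cvg_int mu_ nu (fun z => g z.2 * cos (2 * pi * (k%:R - l%:R) * z.1 + c)).
Proof.
move=> bg; case: (ltngtP k l) => [kl|lk|->].
- have := @error_cos_cvg g (l - k) (- c) _ bg; rewrite subn_gt0 => /(_ kl).
  congr (cvg_int _ _ _); apply/funext => z; congr (_ * _).
  by rewrite natrB ?(ltnW kl)// -cosN; congr cos; ring.
- have := @error_cos_cvg g (k - l) c _ bg; rewrite subn_gt0 => /(_ lk).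
  congr (cvg_int _ _ _); apply/funext => z; congr (_ * _).
  by rewrite natrB ?(ltnW lk)//; congr cos; ring.
(* For equal frequencies the cosine is the constant [cos c], and [g z.2] has the same integral under
   every [mu_ n] and under [nu], whose second marginals are all [mu]. *)
under [X in cvg_int _ _ X]eq_fun do rewrite subrr mulr0 mul0r add0r mulrC.
apply: cvg_intZ.
have bg2 : bmeas (fun z : R * R => g z.2) by exact: bmeas_comp.
split => //.
have -> : \int[nu]_z g z.2 = \int[mu]_y g y.
  under eq_Rintegral do rewrite -[g _]mul1r.
  by rewrite (int_prodM u mu (bmeas_cst R 1) bg) int_cst mul1r.
by under eq_fun do rewrite int_error_law//; exact: cvg_cst.
Qed.

(** The equidistribution criterion applies: the scaled error never leaves [[-1/2, 1/2]] and [u] is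
    carried by this interval, so the outside is null for all the laws involved. *)
Lemma error_cvg_int (f : R * R -> R) (B : R) :
  continuous f -> (forall z, `|f z| <= B) -> cvg_int mu_ nu f.
Proof.
pose out : set R := [set v : R | 2^-1 < `|v|].
have mout : measurable out.
  rewrite -[X in measurable X]setTI.
  by apply: measurable_fun_ltr => //; exact: measurableT_comp.
have outE : (\1_[set z : R * R | 2^-1 < `|z.1|] : R * R -> R) = fun z => \1_out z.1.
  by apply/funext => z; rewrite !indicE; congr (nat_of_bool _)%:R; apply/idP/idP; rewrite !inE.
have bout : bmeas (fun z : R * R => \1_out z.1 : R).
  exact: (@bmeas_comp _ _ _ _ R \1_out fst (bmeas_indic _ mout) measurable_fst).
have nuout : \int[nu]_z \1_out z.1 = 0.
  under eq_Rintegral do rewrite -[\1_out _]mulr1.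
  rewrite (int_prodM u mu (bmeas_indic _ mout) (bmeas_cst R 1)).
  by rewrite uniform_out// mul0r.
apply: cvg_int_continuous.
- exact: error_trig_cvg.
- move=> k c k0.
  have bc : bmeas (fun x : R => cos (2 * pi * k%:R * x + c)).
    by apply: bmeas_cos; apply: measurable_funD => //; exact: measurable_funM.
  under eq_Rintegral do rewrite -[cos _]mulr1.
  by rewrite (int_prodM u mu bc (bmeas_cst R 1)) uniform_int_cos// mul0r.
- rewrite outE; split => //; rewrite nuout.
  have muout n : \int[mu_ n]_z \1_out z.1 = 0.
    rewrite int_error_law// -[RHS](int_cst mu); apply: eq_Rintegral => y _ /=.
    rewrite indicE memNset//= /out/=.
    by apply/negP; rewrite -leNgt; exact: quantize_error_le.
  by under eq_fun do rewrite muout; exact: cvg_cst.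
- by rewrite outE.
Qed.

End quantization_error.

(** * Bounded convergence, independence and product laws, Lipschitz and differentiable functions *)

Lemma bounded_cvg0_int d (T : measurableType d) (R : realType)
    (P : probability T R) (h : nat -> T -> R) (C : R) :
  (forall n, measurable_fun [set: T] (h n)) -> (forall n x, `|h n x| <= C) ->
  (forall x, h n x @[n --> \oo] --> 0) -> \int[P]_x h n x @[n --> \oo] --> 0.
Proof.
move=> mh hC h0.
have cC : bmeas (fun _ : T => C) by exact: bmeas_cst.
have := @dominated_cvg _ _ _ P _ measurableT (fun n x => (h n x)%:E)
  (fun=> 0%E) (fun=> C%:E).
rewrite integral0 => H; apply: (fine_cvg (a := 0)); apply: H => //.
- by move=> n; exact/measurable_EFinP.
- by move=> x _; apply: cvg_EFin; [exact: nearW|exact: h0].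
- exact: (bmeas_integrable P cC).
- by move=> n x _; rewrite lee_fin.
Qed.

(** Independence gives the values on rectangles, which determine a product measure. The separate
    [mu] allows the second factor to be a law agreeing with that of [Y] only on measurable sets. *)
Lemma pair_law_independent (R : realType) d (Omega : measurableType d)
    (P : probability Omega R) (V Y : {RV P >-> R}) (mu : probability R R) :
  same_law (distribution P Y) mu -> independent_rv V Y ->
  forall A, measurable A ->
    distribution P (pair_rv V Y) A = (distribution P V \x mu)%E A.
Proof.
move=> Ymu VY A mA; apply/esym.
apply: (@product_measure_unique _ _ _ _ _ (distribution P V) mu) => // B C mB mC.
transitivity (distribution P V B * distribution P Y C)%E; first exact: VY.
by congr (_ * _)%E; exact: Ymu.
Qed.

Lemma lipschitz_bound (R : realType) (phi : R -> R) : lipschitz phi ->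
  exists2 L, 0 <= L & forall x y, `|phi x - phi y| <= L * `|x - y|.
Proof.
(* [lipschitz] asserts the bound for all constants above the threshold [M]; [|M| + 1] is one of them
   and is nonnegative. *)
move=> [M [_ ML]]; exists (`|M| + 1) => [|x y]; first by rewrite addr_ge0.
apply: (ML _ _ (x, y)) => //.
by rewrite (le_lt_trans (ler_norm M))// ltrDl.
Qed.

Lemma derivable_continuous (R : realType) (phi : R -> R) :
  (forall x, derivable phi x 1) -> continuous phi.
Proof.
move=> dphi x.
by apply: differentiable_continuous; apply/derivable1_diffP.
Qed.

Lemma derive1_littleo (R : realType) (phi : R -> R) (x e : R) :
  derivable phi x 1 -> 0 < e -> exists2 dl, 0 < dl & forall y, `|y - x| < dl ->
  `|phi y - phi x - (y - x) * derive1 phi x| <= e * `|y - x|.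
Proof.
move=> dphi e0; rewrite derive1E.
have : h^-1 *: ((phi \o shift x) (h *: 1) - phi x) @[h --> 0^'] --> 'D_1 phi x.
  exact: dphi.
move/cvgrPdist_le => /(_ _ e0); case/nbhs_ballP => dl /= dl0 H; exists dl => // y yx.
have [->|nyx] := eqVneq y x; first by rewrite !subrr mul0r subrr normr0 mulr0.
have nyx0 : y - x != 0 by rewrite subr_eq0.
have := H (y - x); rewrite /ball/= sub0r normrN => /(_ yx nyx0).
rewrite /GRing.scale/= mulr1 subrK => K.
rewrite (_ : phi y - _ - _ = (y - x) * ((y - x)^-1 * (phi y - phi x) - 'D_1 phi x)).
  by rewrite normrM [leLHS]mulrC ler_wpM2r// distrC.
by rewrite [RHS]mulrBr mulVKf.
Qed.

Lemma derive1_lipschitz (R : realType) (phi : R -> R) (L : R) (x : R) :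
  (forall x y, `|phi x - phi y| <= L * `|x - y|) -> derivable phi x 1 ->
  `|derive1 phi x| <= L.
Proof.
move=> phiL dphi; apply/ler_addgt0Pr => e e0.
have [dl dl0 H] := derive1_littleo dphi e0.
pose h : R := dl / 2; have h0 : 0 < h by rewrite divr_gt0.
have := H (x + h); rewrite (_ : x + h - x = h); last by ring.
rewrite (gtr0_norm h0) => /(_ _)/wrap[|D]; first by rewrite /h; lra.
have := phiL (x + h) x; rewrite (_ : x + h - x = h); last by ring.
rewrite (gtr0_norm h0) => D'.
rewrite -(ler_pM2r h0) -[X in _ * X <= _](gtr0_norm h0) -normrM.
have -> : derive1 phi x * h = (phi (x + h) - phi x) -
  (phi (x + h) - phi x - h * derive1 phi x) by ring.
by rewrite (le_trans (ler_normB _ _))// mulrDl lerD.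
Qed.

Lemma bmeas_derive1_sqr (R : realType) (phi : R -> R) : C1_Lip phi ->
  bmeas (fun y => derive1 phi y ^+ 2).
Proof.
move=> [dphi cphi' /lipschitz_bound[L L0 phiL]]; split.
  by apply: measurable_funX; exact: continuous_measurable_fun.
exists (L ^+ 2) => x; rewrite normrX ler_sqr ?nnegrE//.
exact: derive1_lipschitz.
Qed.

(** * The mean square error of a smooth function of the quantized variable *)

Section mean_square_error.
Context d (Omega : measurableType d) (R : realType) (P : probability Omega R).
Context (Y : {RV P >-> R}).

Lemma scaled_increment_le (phi : R -> R) (L : R) n w : 0 <= L ->
  (forall x y, `|phi x - phi y| <= L * `|x - y|) ->
  `|n%:R * (phi (quantized_rv n Y w) - phi (Y w))| <= L.
Proof.
move=> L0 phiL; rewrite normrM (le_trans (ler_wpM2l (normr_ge0 _) (phiL _ _)))//.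
rewrite mulrCA -normrM ler_piMr// (le_trans (quantize_error_le n (Y w)))//.
by rewrite invf_le1// ler1n.
Qed.

Lemma measurable_increment (phi : R -> R) n : measurable_fun [set: R] phi ->
  measurable_fun [set: Omega] (fun w => phi (quantized_rv n Y w) - phi (Y w)).
Proof.
move=> mphi; apply: measurable_funB; last exact: measurableT_comp.
by apply: measurableT_comp => //; exact: measurable_quantized_rv.
Qed.

(** The scaled increment [a n] is compared with its linearization [b n]: their squares differ by a
    bounded sequence tending to [0] pointwise, and [b n ^+ 2] is the continuous bounded function [f]
    of the scaled error and [Y]. *)
Lemma mean_square_error_cvg (phi : R -> R) : Rajchman (distribution P Y) ->
  C1_Lip phi ->
  \int[P]_w ((n%:R * (phi (quantized_rv n Y w) - phi (Y w))) ^+ 2) @[n --> \oo]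
  --> 12^-1 * \int[distribution P Y]_y (derive1 phi y ^+ 2).
Proof.
move=> raj phiC; have [dphi cphi' /lipschitz_bound[L L0 phiL]] := phiC.
have phi'L x : `|derive1 phi x| <= L by exact: derive1_lipschitz.
have mphi : measurable_fun [set: R] phi.
  by apply: continuous_measurable_fun; exact: derivable_continuous.
have mphi' : measurable_fun [set: R] (derive1 phi).
  exact: continuous_measurable_fun.
pose f (z : R * R) := Num.min (z.1 ^+ 2) (4^-1) * derive1 phi z.2 ^+ 2.
have phi'2 x : `|derive1 phi x ^+ 2| <= L ^+ 2.
  by rewrite normrX ler_sqr ?nnegrE.
have cf : continuous f.
  have c1 : continuous (fun z : R * R => Num.min (z.1 ^+ 2) (4^-1) : R).
    rewrite (_ : (fun z => _) =
        fun z : R * R => (z.1 ^+ 2 + 4^-1 - `|z.1 ^+ 2 - 4^-1|) / 2); last first.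
      by apply/funext => z; rewrite minr_absE.
    move=> z; have c2 : z.1 ^+ 2 @[z --> z] --> z.1 ^+ 2.
      by rewrite expr2; under eq_fun do rewrite expr2; apply: cvgM; exact: cvg_fst.
    apply: cvgM; last exact: cvg_cst.
    apply: cvgB; first by apply: cvgD => //; exact: cvg_cst.
    by apply: cvg_norm; apply: cvgB => //; exact: cvg_cst.
  have c3 : continuous (fun z : R * R => derive1 phi z.2).
    by move=> z; apply: (continuous_comp _ (cphi' _)); exact: cvg_snd.
  move=> z; apply: cvgM; first exact: c1.
  by rewrite expr2; under eq_fun do rewrite expr2; apply: cvgM; exact: c3.
have fB z : `|f z| <= 4^-1 * L ^+ 2.
  rewrite normrM ler_pM// ger0_norm; first by rewrite ge_min lexx orbT.
  by rewrite le_min sqr_ge0 invr_ge0 ler0n.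
(* No variable [V] is given here, so the limit is taken with the explicit uniform law. *)
have [bf fcvg] := error_cvg_int raj (@uniform_half_same_law R) cf fB.
have bphi' : bmeas (fun y => derive1 phi y ^+ 2) by exact: bmeas_derive1_sqr.
have nuf : \int[(uniform_half R \x distribution P Y)%E]_z f z =
    12^-1 * \int[distribution P Y]_y (derive1 phi y ^+ 2).
  rewrite (int_prodM _ _ (bmeas_min_sqr R) bphi').
  by rewrite (uniform_int_sqr (@uniform_half_same_law R)).
pose a n w := n%:R * (phi (quantized_rv n Y w) - phi (Y w)).
pose b n w := scaled_error n Y w * derive1 phi (Y w).
have err n w : `|n%:R * (quantized_rv n Y w - Y w)| <= 2^-1.
  exact: quantize_error_le.
have aL n w : `|a n w| <= L by exact: scaled_increment_le.
have bL n w : `|b n w| <= L.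
  rewrite normrM mulrC (le_trans (ler_wpM2r (normr_ge0 _) (phi'L _)))//.
  by rewrite ler_piMr// (le_trans (err n w))// invf_le1// ler1n.
have ma n : measurable_fun [set: Omega] (a n).
  by apply: measurable_funM => //; exact: measurable_increment.
have mb n : measurable_fun [set: Omega] (b n).
  apply: measurable_funM; first exact: measurable_scaled_error.
  exact: measurableT_comp.
have sq (h : nat -> Omega -> R) : (forall n : nat, measurable_fun [set: Omega] (h n)) ->
    (forall n w, `|h n w| <= L) -> forall n, bmeas (fun w => h n w ^+ 2).
  move=> mh hL n; split; first exact: measurable_funX.
  by exists (L ^+ 2) => w; rewrite normrX ler_sqr ?nnegrE.
have abcvg : \int[P]_w (a n w ^+ 2 - b n w ^+ 2) @[n --> \oo] --> 0.
  apply: (@bounded_cvg0_int _ _ _ _ _ (2 * L * (2 * L))).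
  - by move=> n; apply: measurable_funB; exact: measurable_funX.
  - move=> n w; rewrite subr_sqr normrM ler_pM// mulr_natl mulr2n.
      by rewrite (le_trans (ler_normB _ _))// lerD.
    by rewrite (le_trans (ler_normD _ _))// lerD.
  move=> w; suff ab : a n w - b n w @[n --> \oo] --> 0.
    (* From [a^2 - b^2 = (a - b)(a + b)] with [|a + b| <= 2 * L]; the added [1] keeps the divisor
       positive when [L = 0]. *)
    apply/cvgrPdist_le => e e0; have eL : 0 < e / (2 * L + 1).
      by rewrite divr_gt0// ltr_wpDl// mulr_ge0.
    move/cvgrPdist_le : ab => /(_ _ eL); apply: filterS => n.
    rewrite !sub0r !normrN subr_sqr normrM => abn.
    have abL : `|a n w + b n w| <= 2 * L + 1.
      by rewrite (le_trans (ler_normD _ _))//; have := aL n w; have := bL n w; lra.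
    rewrite (le_trans (ler_pM (normr_ge0 _) (normr_ge0 _) abn abL))//.
    by rewrite mulfVK// gt_eqF// ltr_wpDl// mulr_ge0.
  (* The first-order remainder is at most [e |Y_n - Y|] once [Y_n] is close to [Y]; multiplied by
     [n] it stays below [e], because [n |Y_n - Y| <= 1/2]. *)
  apply/cvgrPdist_le => e e0; have [dl dl0 H] := derive1_littleo (dphi (Y w)) e0.
  have /cvgrPdist_lt /(_ _ dl0) := @quantize_cvg R (Y w).
  apply: filterS => n; rewrite distrC => /H{H} H; rewrite sub0r normrN.
  rewrite (_ : a n w - b n w = n%:R * (phi (quantize n (Y w)) - phi (Y w) -
    (quantize n (Y w) - Y w) * derive1 phi (Y w))); last first.
    by rewrite /a /b /scaled_error /quantized_rv; ring.
  rewrite normrM (le_trans (ler_wpM2l (normr_ge0 _) H))//.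
  rewrite mulrCA -normrM ler_piMr ?(ltW e0)// (le_trans (err n w))//.
  by rewrite invf_le1// ler1n.
have bcvg : \int[P]_w (b n w ^+ 2) @[n --> \oo] -->
    12^-1 * \int[distribution P Y]_y (derive1 phi y ^+ 2).
  rewrite -nuf; move: fcvg; apply: cvg_trans.
  apply: near_eq_cvg; apply: nearW => n.
  rewrite bmeas_int_distribution//; apply: eq_Rintegral => w _.
  rewrite /f /= /b [RHS]exprMn; congr (_ * _); apply/min_idPl.
  rewrite -[_ ^+ 2]real_normK ?num_real//.
  rewrite (_ : 4^-1 = 2^-1 ^+ 2 :> R); last by field.
  by rewrite ler_sqr ?nnegrE// ?invr_ge0//; exact: err.
have abb n : \int[P]_w (a n w ^+ 2) =
    \int[P]_w (a n w ^+ 2 - b n w ^+ 2) + \int[P]_w (b n w ^+ 2).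
  by rewrite bmeas_intB; [rewrite subrK|exact: sq|exact: sq].
under eq_fun do rewrite abb.
by have := cvgD abcvg bcvg; rewrite add0r; apply.
Qed.

End mean_square_error.

Theorem theorem1 (R : realType) (d : measure_display)
    (Omega : measurableType d) (P : probability Omega R) (Y : {RV P >-> R}) :
  Rajchman (distribution P Y) ->
  (forall (d' : measure_display) (Omega' : measurableType d')
      (P' : probability Omega' R) (V Y' : {RV P' >-> R}),
    same_law (distribution P' V) (uniform_prob (ltNhalf R)) ->
    same_law (distribution P' Y') (distribution P Y) ->
    independent_rv V Y' ->
    weak_cvg (fun n => distribution P (pair_rv (scaled_error n Y) Y))
             (distribution P' (pair_rv V Y'))) /\
  (forall phi : R -> R, C1_Lip phi ->
    ((n%:R ^+ 2)%R%:E *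
      'E_P[(fun w => (phi (quantized_rv n Y w) - phi (Y w)) ^+ 2)%R])%E
      @[n --> \oo] -->
    ((12^-1)%R%:E * \int[distribution P Y]_y ((derive1 phi y) ^+ 2)%R%:E)%E).
Proof.
move=> raj; split => [d' Omega' P' V Y' Vunif Ylaw VY f cf [B [_ fB]]|phi phiC].
  have fB' z : `|f z| <= `|B| + 1.
    by apply: (fB (`|B| + 1)) => //; rewrite (le_lt_trans (ler_norm B))// ltrDl.
  have [bf fcvg] := error_cvg_int raj Vunif cf fB'.
  (* By independence the limit law is the product of the law of [V] and that of [Y]. *)
  rewrite (eq_measure_integral (distribution P' V \x distribution P Y)%E); last first.
    by move=> A mA _; exact: pair_law_independent.
  rewrite bmeas_intE//; under eq_fun do rewrite bmeas_intE//.
  by apply: cvg_EFin => //; exact: nearW.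
rewrite bmeas_intE -?EFinM; last exact: bmeas_derive1_sqr.
have [dphi cphi' /lipschitz_bound[L L0 phiL]] := phiC.
have mphi : measurable_fun [set: R] phi.
  by apply: continuous_measurable_fun; exact: derivable_continuous.
have : (\int[P]_w ((n%:R * (phi (quantized_rv n Y w) - phi (Y w))) ^+ 2))%:E
    @[n --> \oo] --> (12^-1 * \int[distribution P Y]_y (derive1 phi y ^+ 2))%:E.
  by apply: cvg_EFin; [exact: nearW|exact: mean_square_error_cvg].
apply: cvg_trans.
apply: near_eq_cvg; near=> n.
have n0 : n%:R != 0 :> R.
  by rewrite pnatr_eq0 -lt0n; near: n; exact: nbhs_infty_gt.
have bq : bmeas (fun w => (phi (quantized_rv n Y w) - phi (Y w)) ^+ 2).
  split; first by apply: measurable_funX; exact: measurable_increment.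
  (* The bound [L] on the scaled increment, divided by the nonzero [n] and squared. *)
  exists ((n%:R^-1 * L) ^+ 2) => w; rewrite normrX ler_sqr ?nnegrE ?mulr_ge0//.
  rewrite -(ler_pM2l (_ : 0 < `|n%:R|)) ?normr_gt0// -normrM.
  rewrite (le_trans (scaled_increment_le Y n w L0 phiL))// mulrA ger0_norm//.
  by rewrite divff// mul1r.
rewrite unlock bmeas_intE// -EFinM -bmeas_intZ//.
by congr EFin; apply: eq_Rintegral => w _; rewrite exprMn.
Unshelve. all: by end_near. Qed.
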